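(* For an arbitrary point $w\in\widetilde\Omega$, the projection $\mathcal{P}_{\mathcal{M}}(w)$ is given blockwise by $$\mathcal{P}_{\mathcal{M}}(w)_l=\begin{cases}0, & l<f_1(w)\ \text{or}\ l>f_2(w),\\[4pt] \dfrac{w_l}{1-\mu-l\lambda}, & f_1(w)\le l\le f_2(w),\end{cases}$$ where $$\lambda=r\sqrt{\sum_{l=f_1(w)}^{f_2(w)}\frac{\|w_l\|_2^2}{[1-(l-M)r]^2}},\qquad \mu=1-(1+Mr)\sqrt{\sum_{l=f_1(w)}^{f_2(w)}\frac{\|w_l\|_2^2}{[1-(l-M)r]^2}},$$ and $r$ is the unique zero of the function $$h_1(t)=\sum_{l=f_1(w)}^{f_2(w)}\frac{(l-M)\|w_l\|_2^2}{[1-(l-M)t]^2},\qquad t\in\Big(\frac{1}{f_1(w)-M},\frac{1}{f_2(w)-M}\Big).$$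
   Context: Let $F\ge 1$ be an integer, $n$ a positive even integer, $N=2n(2F+1)$, and let $M$ be a real number with $0\le M<F$ and $M\notin\mathbb{Z}$. Vectors $w\in\mathbb{R}^N$ are written in blocks $w=(w_F;w_{F-1};\dots;w_{-F})$ with $w_l\in\mathbb{R}^{2n}$, the index $l$ ranging over the integers from $-F$ to $F$. Define $$\mathcal{M}=\Big\{u\in\mathbb{R}^N : \sum_{l=-F}^F\|u_l\|_2^2=1,\ \sum_{l=-F}^F l\,\|u_l\|_2^2=M\Big\},$$ a closed embedded submanifold of $\mathbb{R}^N$ of dimension $N-2$. For $w\neq0$ put $f_1(w)=\min\{l : w_l\ne 0\}$ and $f_2(w)=\max\{l : w_l\neq 0\}$. Let $$\Omega=\Big\{w\in\mathbb{R}^N : \sum_{l<M}\|w_l\|_2^2>0,\ \sum_{l>M}\|w_l\|_2^2>0\Big\},$$ an open set containing $\mathcal{M}$. The projection operator is $\mathcal{P}_{\mathcal{M}}(w)=\arg\min_{z\in\mathcal{M}}\frac12\|z-w\|_2^2$. Finally $\widetilde\Omega\subset\Omega$ denotes a neighborhood of $\mathcal{M}$ on which $\mathcal{P}_{\mathcal{M}}$ is well defined, i.e. for every $w\in\widetilde\Omega$ the minimizer exists and is unique. *)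

(* Defs.v *)
From HB Require Import structures.
From mathcomp Require Import all_boot all_order all_algebra.
From mathcomp Require Import all_classical all_reals all_analysis.

Set Implicit Arguments.
Unset Strict Implicit.
Unset Printing Implicit Defensive.

Import Order.TTheory GRing.Theory Num.Theory.
Import numFieldNormedType.Exports.

Local Open Scope classical_set_scope.
Local Open Scope ring_scope.

Section Projection.
Context {R : realType}.

(* The norm that MathComp-Analysis puts on matrices is the max norm; it induces
   the same topology, but the Euclidean norm has to be defined separately. *)
Definition norm2 k (x : 'rV[R]_k) : R := Num.sqrt (\sum_j x ord0 j ^+ 2).

(* The blocks come in the order w_F, w_(F-1), ..., w_(-F): the block at
   position i carries the index l = F - i, so l ranges over -F, ..., F. *)
Definition level (F : nat) (i : 'I_(2 * F + 1)) : int := F%:Z - i%:Z.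

Section Fixed.
Variables (F n : nat).
Notation V := 'rV[R]_((2 * F + 1) * (2 * n)).

Definition block (w : V) (i : 'I_(2 * F + 1)) : 'rV[R]_(2 * n) :=
  row i (vec_mx w).

(* The default values F and -F only matter for w = 0: they bound all levels. *)
Definition f_1 (w : V) : int :=
  \big[Order.min/F%:Z]_(i | block w i != 0) level i.
Definition f_2 (w : V) : int :=
  \big[Order.max/- F%:Z]_(i | block w i != 0) level i.

Variable M : R.

Definition manifold : set V :=
  [set u | \sum_i norm2 (block u i) ^+ 2 = 1 /\
           \sum_i (level i)%:~R * norm2 (block u i) ^+ 2 = M].

Definition Omega : set V :=
  [set w | 0 < \sum_(i | (level i)%:~R < M) norm2 (block w i) ^+ 2 /\
           0 < \sum_(i | M < (level i)%:~R) norm2 (block w i) ^+ 2].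

Definition minimizers (w : V) : set V :=
  [set z | manifold z /\
     forall y, manifold y ->
       2^-1 * norm2 (z - w) ^+ 2 <= 2^-1 * norm2 (y - w) ^+ 2].

(* Junk value 0 when there is no minimizer, an arbitrary one when there are
   several. *)
Definition projM (w : V) : V := xget 0 (minimizers w).

Definition well_defined_nbhd (U : set V) : Prop :=
  [/\ manifold `<=` U°, U `<=` Omega &
      forall w, U w -> exists! z, minimizers w z].

Definition h_1 (w : V) (t : R) : R :=
  \sum_(i | f_1 w <= level i <= f_2 w)
    ((level i)%:~R - M) * norm2 (block w i) ^+ 2 /
      (1 - ((level i)%:~R - M) * t) ^+ 2.

Definition h_1_dom (w : V) : set R :=
  [set` `](((f_1 w)%:~R - M)^-1), (((f_2 w)%:~R - M)^-1)[].

Definition proj_scale (w : V) (r : R) : R :=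
  Num.sqrt (\sum_(i | f_1 w <= level i <= f_2 w)
    norm2 (block w i) ^+ 2 / (1 - ((level i)%:~R - M) * r) ^+ 2).

Definition proj_lambda (w : V) (r : R) : R := r * proj_scale w r.
Definition proj_mu (w : V) (r : R) : R := 1 - (1 + M * r) * proj_scale w r.

End Fixed.
End Projection.

(* Main.v *)
Require Import Defs.
From HB Require Import structures.
From mathcomp Require Import all_boot all_order all_algebra.
From mathcomp Require Import all_classical all_reals all_analysis.
From mathcomp Require Import ring zify.

Import Order.TTheory GRing.Theory Num.Theory.
Import numFieldNormedType.Exports.

Local Open Scope classical_set_scope.
Local Open Scope ring_scope.

(** The function [h_1] is a secular function: on its interval every
    [1 - (l - M) t] is positive, every term is nondecreasing, the terms of the
    extremal levels are strictly monotone, and these two terms dominate near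
    the two ends of the interval and give [h_1] opposite signs there.  So
    [h_1] has exactly one zero [r] ([secular_root]).

    Let [s] be [proj_scale M w r] and [u] the point given by the formula, so
    that [w_l = d_l u_l] for all [l], where [d_l = s (1 - (l - M) r)] is affine
    in [l] and positive for [f_1 w <= l <= f_2 w].  The choice of [s] gives the
    first constraint of the manifold for [u], and [h_1 M w r = 0] the second
    one ([scaled_point_in_manifold]).

    To compare [u] with another point [z] of the manifold, note that [z] and
    [u] satisfy the same two constraints and that [d_l] is affine in [l];
    expanding the squares therefore gives the exact identity
    [|z - w|^2 - |u - w|^2 = \sum_l d_l |z_l - u_l|^2] ([dist_defect]).  When [z]
    is the minimizer, the left-hand side is nonpositive, so it is enough that
    no summand is negative.  A negative [d_l] is possible only outside
    [f_1 w, ..., f_2 w], where [w_l = 0]; there the uniqueness of the minimizer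
    is used: changing the sign of [z_l] yields another minimizer, so [z_l = 0]
    ([minimizer_block_eq0]), and the summand vanishes.  Hence all summands are
    zero and [z = u]. *)

(** * The secular equation *)

Definition secular {R : realType} {I : finType} (P : pred I) (m a : I -> R)
    (t : R) : R :=
  \sum_(i | P i) m i * a i / (1 - m i * t) ^+ 2.

Lemma secular_opp {R : realType} {I : finType} (P : pred I) (m a : I -> R)
    (t : R) :
  secular P (fun i => - m i) a t = - secular P m a (- t).
Proof.
rewrite /secular -sumrN; apply: eq_bigr => i _.
by rewrite !mulNr mulrN.
Qed.

Lemma secular_denom_gt0 {R : realType} {p q m t : R} :
  p < 0 -> 0 < q -> p <= m <= q -> p^-1 < t < q^-1 -> 0 < 1 - m * t.
Proof.
move=> p0 q0 /andP[pm mq] /andP[pt tq].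
have pt1 : p * t < 1 by rewrite -[ltRHS](@mulfV _ p) ?lt_eqF // ltr_nM2l.
have qt1 : q * t < 1 by rewrite -[ltRHS](@mulfV _ q) ?gt_eqF // ltr_pM2l.
rewrite subr_gt0; have [t0|t0] := leP 0 t.
  by apply: le_lt_trans qt1; apply: ler_wpM2r.
by apply: le_lt_trans pt1; apply: ler_wnM2r => //; apply: ltW.
Qed.

(** The difference of the two sides has the factor [m ^+ 2], so the term grows
    whatever the sign of [m]. *)
Lemma secular_term_le {R : realType} {m a s t : R} :
  0 <= a -> 0 < 1 - m * s -> 0 < 1 - m * t -> s < t ->
  m * a / (1 - m * s) ^+ 2 <= m * a / (1 - m * t) ^+ 2
    ?= iff (m * a == 0).
Proof.
move=> a0 ds dt st.
have E : m * a / (1 - m * t) ^+ 2 - m * a / (1 - m * s) ^+ 2 =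
    m ^+ 2 * a * ((t - s) * ((1 - m * s) + (1 - m * t)) /
                  ((1 - m * t) ^+ 2 * (1 - m * s) ^+ 2)).
  by field; rewrite !gt_eqF.
have K : 0 < (t - s) * ((1 - m * s) + (1 - m * t)) /
             ((1 - m * t) ^+ 2 * (1 - m * s) ^+ 2).
  have dts : 0 < t - s by rewrite subr_gt0.
  by apply: divr_gt0; apply: mulr_gt0; rewrite ?exprn_gt0 //; apply: addr_gt0.
split.
  by rewrite -subr_ge0 E mulr_ge0 ?(ltW K) // mulr_ge0 ?sqr_ge0.
rewrite eq_sym -subr_eq0 E mulf_eq0 (gt_eqF K) orbF !mulf_eq0.
by case: (m == 0).
Qed.

Lemma secular_mono {R : realType} {I : finType} {P : pred I} {m a : I -> R}
    {p q : R} {i1 : I} {s t : R} :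
  p < 0 -> 0 < q -> (forall i, P i -> p <= m i <= q) ->
  (forall i, 0 <= a i) -> P i1 -> 0 < a i1 -> m i1 = q ->
  p^-1 < s < q^-1 -> p^-1 < t < q^-1 -> s < t ->
  secular P m a s < secular P m a t.
Proof.
move=> p0 q0 mpq a0 Pi1 ai1 mi1 sd td st.
have T i : P i ->
    m i * a i / (1 - m i * s) ^+ 2 <= m i * a i / (1 - m i * t) ^+ 2
    ?= iff (m i * a i == 0).
  move=> Pi; apply: secular_term_le => //.
    exact: secular_denom_gt0 p0 q0 (mpq i Pi) sd.
  exact: secular_denom_gt0 p0 q0 (mpq i Pi) td.
rewrite /secular (bigD1 i1) //= [X in _ < X](bigD1 i1) //=.
apply: ltr_leD; last by apply: ler_sum => i /andP[Pi _]; apply: (T i Pi).1.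
by rewrite (lt_leif (T i1 Pi1)) mi1 mulf_neq0 ?gt_eqF.
Qed.

(** For [t >= 0] every other term is at least [- |m i| * a i], while the term of
    [i1] tends to infinity at [q^-1]. *)
Lemma secular_ge0_near_pole {R : realType} {I : finType} {P : pred I}
    {m a : I -> R} {q : R} {i1 : I} :
  0 < q -> (forall i, 0 <= a i) -> P i1 -> 0 < a i1 -> m i1 = q ->
  exists2 t, 0 <= t < q^-1 & 0 <= secular P m a t.
Proof.
move=> q0 a0 Pi1 ai1 mi1.
pose A := \sum_(i | P i && (i != i1)) `|m i| * a i.
have A0 : 0 <= A by apply: sumr_ge0 => i _; rewrite mulr_ge0.
have c0 : 0 < q * a i1 by rewrite mulr_gt0.
have cA : 0 < q * a i1 + A by rewrite ltr_wpDr.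
(* e is the value of 1 - q t at the chosen t; as e <= 1, the dominant term
   q a / e ^+ 2 is at least q a / e = q a + A. *)
pose e := q * a i1 / (q * a i1 + A).
have e0 : 0 < e by rewrite divr_gt0.
have e1 : e <= 1 by rewrite ler_pdivrMr // mul1r lerDl.
have t0 : 0 <= (1 - e) / q by rewrite divr_ge0 ?subr_ge0 // ltW.
exists ((1 - e) / q).
  by rewrite t0 /= -[ltRHS]mul1r ltr_pM2r ?invr_gt0 // ltrBlDr ltrDl.
rewrite /secular (bigD1 i1) //= mi1.
have -> : 1 - q * ((1 - e) / q) = e by field; rewrite gt_eqF.
have H1 : A <= q * a i1 / e ^+ 2.
  apply: (@le_trans _ _ (q * a i1 / e)).
    by rewrite /e invfM invrK mulrA mulfV ?gt_eqF // mul1r lerDr ltW.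
  rewrite ler_pM2l // lef_pV2 ?posrE ?exprn_gt0 // expr2.
  by rewrite ler_piMl // ltW.
have H2 : - A <= \sum_(i | P i && (i != i1))
    m i * a i / (1 - m i * ((1 - e) / q)) ^+ 2.
  rewrite /A -sumrN; apply: ler_sum => i _.
  have [mi|mi] := leP 0 (m i).
    apply: (@le_trans _ _ 0); first by rewrite oppr_le0 mulr_ge0.
    by rewrite divr_ge0 ?sqr_ge0 ?mulr_ge0.
  rewrite -mulNr ltr0_norm // opprK.
  set d := (X in _ / X).
  have d1 : 1 <= d.
    rewrite /d exprn_ege1 // lerBrDr -lerBrDl subrr.
    by rewrite mulr_le0_ge0 // ltW.
  rewrite ler_pdivlMr ?(lt_le_trans ltr01) // ler_neMr //.
  by rewrite mulr_le0_ge0 // ltW.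
by have := lerD H1 H2; rewrite subrr.
Qed.

Lemma secular_continuous {R : realType} {I : finType} {P : pred I}
    {m a : I -> R} {x : R} :
  (forall i, P i -> 1 - m i * x != 0) ->
  {for x, continuous (secular P m a)}.
Proof.
move=> d.
have Hx : forall i, P i ->
    {for x, continuous (fun t : R => m i * a i / (1 - m i * t) ^+ 2)}.
  move=> i Pi; apply: cvgM; first exact: cvg_cst.
  apply: cvgV; first by rewrite expf_neq0 ?d.
  have c1 : (1 - m i * t) @[t --> x] --> (1 - m i * x).
    by apply: cvgB; [exact: cvg_cst|apply: cvgM; [exact: cvg_cst|exact: cvg_id]].
  by under eq_fun do rewrite expr2; rewrite expr2; apply: cvgM.
by apply: cvg_big => //; exact: add_continuous.
Qed.

Lemma secular_root {R : realType} {I : finType} {P : pred I} {m a : I -> R}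
    {p q : R} (i0 i1 : I) :
  p < 0 -> 0 < q -> (forall i, P i -> p <= m i <= q) ->
  (forall i, 0 <= a i) -> P i0 -> 0 < a i0 -> m i0 = p ->
  P i1 -> 0 < a i1 -> m i1 = q ->
  exists r, [/\ p^-1 < r < q^-1, secular P m a r = 0 &
    forall t, p^-1 < t < q^-1 -> secular P m a t = 0 -> t = r].
Proof.
move=> p0 q0 mpq a0 Pi0 ai0 mi0 Pi1 ai1 mi1.
have [t /andP[t0 tq] ht] := secular_ge0_near_pole q0 a0 Pi1 ai1 mi1.
(* The reflection t |-> - t, m |-> - m moves the pole p^-1 to the right end. *)
have [s /andP[s0 sp] hs] : exists2 s, 0 <= s < (- p)^-1 &
    0 <= secular P (fun i => - m i) a s.
  by apply: (@secular_ge0_near_pole _ _ _ _ _ _ i0); rewrite ?oppr_gt0 ?mi0.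
rewrite secular_opp oppr_ge0 in hs; rewrite invrN ltrNr in sp.
have st : - s <= t by apply: le_trans t0; rewrite oppr_le0.
have inD x : x \in `[- s, t] -> p^-1 < x < q^-1.
  rewrite in_itv /= => /andP[sx xt].
  by rewrite (lt_le_trans sp sx) (le_lt_trans xt tq).
have [||r /inD rd hr] := @IVT R (secular P m a) (- s) t 0 st.
- apply: continuous_in_subspaceT => x /set_mem/inD xd.
  apply: secular_continuous => i Pi.
  by rewrite gt_eqF // (secular_denom_gt0 p0 q0 (mpq i Pi)).
- by rewrite ge_min le_max hs ht orbT.
exists r; split => // x xd hx.
have [xr|rx|//] := ltgtP x r.
  have := secular_mono p0 q0 mpq a0 Pi1 ai1 mi1 xd rd xr.
  by rewrite hx hr ltxx.
have := secular_mono p0 q0 mpq a0 Pi1 ai1 mi1 rd xd rx.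
by rewrite hx hr ltxx.
Qed.

(** * Euclidean norms of blocks *)

Lemma norm2_sqrE {R : realType} {k : nat} (x : 'rV[R]_k) :
  norm2 x ^+ 2 = \sum_j x ord0 j ^+ 2.
Proof. by rewrite sqr_sqrtr // sumr_ge0 // => j _; apply: sqr_ge0. Qed.

Lemma norm2_sqr_eq0 {R : realType} {k : nat} (x : 'rV[R]_k) :
  (norm2 x ^+ 2 == 0) = (x == 0).
Proof.
rewrite norm2_sqrE psumr_eq0; last by move=> j _; apply: sqr_ge0.
apply/allP/eqP => [x0|-> j _]; last by rewrite /= mxE expr0n.
apply/rowP => j; apply/eqP; rewrite mxE -sqrf_eq0.
exact: x0 (mem_index_enum j).
Qed.

Lemma norm2_sqrZ {R : realType} {k : nat} (c : R) (x : 'rV[R]_k) :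
  norm2 (c *: x) ^+ 2 = c ^+ 2 * norm2 x ^+ 2.
Proof.
by rewrite !norm2_sqrE mulr_sumr; apply: eq_bigr => j _; rewrite mxE exprMn.
Qed.

Lemma norm2_sqr_blocks {R : realType} {F n : nat}
    (y : 'rV[R]_((2 * F + 1) * (2 * n))) :
  norm2 y ^+ 2 = \sum_i norm2 (block y i) ^+ 2.
Proof.
rewrite norm2_sqrE (reindex _ (curry_mxvec_bij _ _)) /=.
rewrite (eq_bigr (fun p => y ord0 (mxvec_index p.1 p.2) ^+ 2)); last by case.
rewrite -(pair_bigA _ (fun i j => y ord0 (mxvec_index i j) ^+ 2)) /=.
apply: eq_bigr => i _; rewrite norm2_sqrE; apply: eq_bigr => j _.
by rewrite !mxE.
Qed.

Lemma blockB {R : realType} {F n : nat}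
    (y z : 'rV[R]_((2 * F + 1) * (2 * n))) (i : 'I_(2 * F + 1)) :
  block (y - z) i = block y i - block z i.
Proof. by rewrite /block !linearB. Qed.

Lemma block_inj {R : realType} {F n : nat}
    {y z : 'rV[R]_((2 * F + 1) * (2 * n))} : block y =1 block z -> y = z.
Proof.
move=> yz; apply: (can_inj vec_mxK); apply/row_matrixP => i; exact: yz.
Qed.

Definition scale_blocks {R : realType} {F n : nat} (c : 'I_(2 * F + 1) -> R)
    (y : 'rV[R]_((2 * F + 1) * (2 * n))) : 'rV[R]_((2 * F + 1) * (2 * n)) :=
  mxvec (\matrix_i (c i *: block y i)).

Lemma block_scale_blocks {R : realType} {F n : nat} (c : 'I_(2 * F + 1) -> R)
    (y : 'rV[R]_((2 * F + 1) * (2 * n))) (i : 'I_(2 * F + 1)) :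
  block (scale_blocks c y) i = c i *: block y i.
Proof. by rewrite {1}/block mxvecK rowK. Qed.

(** * Extremal levels *)

Lemma level_bounds {F : nat} (i : 'I_(2 * F + 1)) :
  - F%:Z <= level i <= F%:Z.
Proof. by rewrite /level; have := ltn_ord i; lia. Qed.

Lemma f_1_le {R : realType} {F n : nat} {w : 'rV[R]_((2 * F + 1) * (2 * n))}
    {i : 'I_(2 * F + 1)} : block w i != 0 -> f_1 w <= level i.
Proof. by move=> wi; apply: bigmin_le_cond. Qed.

Lemma f_2_ge {R : realType} {F n : nat} {w : 'rV[R]_((2 * F + 1) * (2 * n))}
    {i : 'I_(2 * F + 1)} : block w i != 0 -> level i <= f_2 w.
Proof. by move=> wi; apply: le_bigmax_cond. Qed.

Lemma f_1_attained {R : realType} {F n : nat}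
    {w : 'rV[R]_((2 * F + 1) * (2 * n))} {i : 'I_(2 * F + 1)} :
  block w i != 0 -> exists2 j, block w j != 0 & f_1 w = level j.
Proof.
move=> wi.
have [|j wj fj] := @Order.TotalTheory.eq_bigmin _ _ _ F%:Z i
  (fun j => block w j != 0) (@level F) wi.
  by move=> j _; have /andP[] := level_bounds j.
by exists j.
Qed.

Lemma f_2_attained {R : realType} {F n : nat}
    {w : 'rV[R]_((2 * F + 1) * (2 * n))} {i : 'I_(2 * F + 1)} :
  block w i != 0 -> exists2 j, block w j != 0 & f_2 w = level j.
Proof.
move=> wi.
have [|j wj fj] := @Order.TotalTheory.eq_bigmax _ _ _ (- F%:Z) i
  (fun j => block w j != 0) (@level F) wi.
  by move=> j _; have /andP[] := level_bounds j.
by exists j.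
Qed.

Lemma block_neq0_of_sum_gt0 {R : realType} {F n : nat}
    {w : 'rV[R]_((2 * F + 1) * (2 * n))} {P : pred 'I_(2 * F + 1)} :
  0 < \sum_(i | P i) norm2 (block w i) ^+ 2 ->
  exists2 i, P i & block w i != 0.
Proof.
move=> s0; apply: contrapT => H; move: s0; rewrite big1 ?ltxx // => i Pi.
apply/eqP; rewrite norm2_sqr_eq0; apply: contrapT => wi.
by apply: H; exists i => //; apply/negP.
Qed.

(** * Minimizers and the projection formula *)

(** With [d = alpha + beta * l], each block satisfies the identity
    [|z - d u|^2 - |u - d u|^2 = (1 - d) (|z|^2 - |u|^2) + d |z - u|^2].
    As [1 - d] is affine in the level, the two constraints of the manifold
    cancel the first term on the right in the sum over the blocks. *)
Lemma dist_defect {R : realType} {F n : nat} {M : R}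
    {u z w : 'rV[R]_((2 * F + 1) * (2 * n))} {alpha beta : R} :
  manifold M u -> manifold M z ->
  (forall i, block w i = (alpha + beta * (level i)%:~R) *: block u i) ->
  norm2 (z - w) ^+ 2 - norm2 (u - w) ^+ 2 =
  \sum_i (alpha + beta * (level i)%:~R) * norm2 (block z i - block u i) ^+ 2.
Proof.
move=> [u1 uM] [z1 zM] wE.
rewrite !norm2_sqr_blocks -sumrB.
pose D i := norm2 (block z i) ^+ 2 - norm2 (block u i) ^+ 2.
have D0 : \sum_i D i = 0 by rewrite sumrB u1 z1 subrr.
have DM : \sum_i (level i)%:~R * D i = 0.
  by under eq_bigr do rewrite mulrBr; rewrite sumrB uM zM subrr.
transitivity (\sum_i ((1 - alpha) * D i - beta * ((level i)%:~R * D i) +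
  (alpha + beta * (level i)%:~R) * norm2 (block z i - block u i) ^+ 2)).
  apply: eq_bigr => i _; rewrite !blockB wE /D !norm2_sqrE.
  set d := alpha + _.
  have -> (X Y : R) : (1 - alpha) * X - beta * ((level i)%:~R * X) + Y =
      (1 - d) * X + Y by rewrite /d; ring.
  rewrite -!sumrB mulr_sumr mulr_sumr -big_split /=; apply: eq_bigr => j _.
  by rewrite !mxE; ring.
by rewrite big_split sumrB /= -!mulr_sumr D0 DM !mulr0 subrr add0r.
Qed.

(** Where [w] vanishes, changing the sign of the block of [z] preserves both
    the manifold and the distance to [w]. *)
Lemma minimizer_block_eq0 {R : realType} {F n : nat} {M : R}
    {w z : 'rV[R]_((2 * F + 1) * (2 * n))} {i : 'I_(2 * F + 1)} :
  minimizers M w z -> (forall y, minimizers M w y -> z = y) ->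
  block w i = 0 -> block z i = 0.
Proof.
move=> [[z1 zM] zmin] zuniq wi0.
pose c j : R := (-1) ^+ (j == i).
pose y := scale_blocks c z.
have yE j : norm2 (block y j) ^+ 2 = norm2 (block z j) ^+ 2.
  by rewrite block_scale_blocks norm2_sqrZ sqrr_sign mul1r.
have ymin : minimizers M w y.
  split; first by split; under eq_bigr do rewrite yE.
  move=> x /zmin; suff -> : norm2 (y - w) ^+ 2 = norm2 (z - w) ^+ 2 by [].
  rewrite !norm2_sqr_blocks; apply: eq_bigr => j _; rewrite !blockB.
  have [->|ji] := eqVneq j i; first by rewrite wi0 !subr0 yE.
  by rewrite block_scale_blocks /c (negbTE ji) scale1r.
have := congr1 (@block R F n ^~ i) (zuniq _ ymin).
rewrite block_scale_blocks /c eqxx scaleN1r => /eqP.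
rewrite -addr_eq0 -mulr2n -scaler_nat scaler_eq0 pnatr_eq0 /=.
by move/eqP.
Qed.

(** The factor [proj_scale M w r] normalizes the candidate, which is the first
    constraint; the defect in the second one is a multiple of [h_1 M w r]. *)
Lemma scaled_point_in_manifold {R : realType} {F n : nat} {M r : R}
    {w : 'rV[R]_((2 * F + 1) * (2 * n))} :
  0 < proj_scale M w r -> h_1 M w r = 0 ->
  manifold M (scale_blocks
    (fun i => if f_1 w <= level i <= f_2 w then
       (proj_scale M w r * (1 - ((level i)%:~R - M) * r))^-1 else 0) w).
Proof.
set s := proj_scale M w r => s0 h0; set u := scale_blocks _ _.
have uE i : norm2 (block u i) ^+ 2 = if f_1 w <= level i <= f_2 w then
    s ^- 2 * (norm2 (block w i) ^+ 2 / (1 - ((level i)%:~R - M) * r) ^+ 2) else 0.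
  rewrite block_scale_blocks norm2_sqrZ; case: ifP => _; last first.
    by rewrite expr0n mul0r.
  by rewrite exprVn exprMn invfM -mulrA [X in _ * X]mulrC.
have sE : s ^+ 2 = \sum_(i | f_1 w <= level i <= f_2 w)
    norm2 (block w i) ^+ 2 / (1 - ((level i)%:~R - M) * r) ^+ 2.
  rewrite sqr_sqrtr // sumr_ge0 // => i _.
  by rewrite divr_ge0 ?sqr_ge0.
have u1 : \sum_i norm2 (block u i) ^+ 2 = 1.
  under eq_bigr do rewrite uE.
  by rewrite -big_mkcond -mulr_sumr -sE mulVf // expf_neq0 ?gt_eqF.
have uM : \sum_i M * norm2 (block u i) ^+ 2 = M by rewrite -mulr_sumr u1 mulr1.
split=> //; apply/eqP; rewrite -subr_eq0 -[X in _ - X]uM -sumrB.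
rewrite [X in X == _](_ : _ = s ^- 2 * h_1 M w r); first by rewrite h0 mulr0.
rewrite /h_1 mulr_sumr [RHS]big_mkcond; apply: eq_bigr => i _.
rewrite -mulrBl uE; case: ifP => _; last by rewrite mulr0.
by rewrite mulrCA !mulrA.
Qed.

Theorem lemma6p1 (R : realType) (F n : nat) (M : R)
    (F_ge1 : (1 <= F)%N) (n_gt0 : (0 < n)%N) (n_even : ~~ odd n)
    (M_ge0 : 0 <= M) (M_ltF : M < F%:R) (M_nint : M \isn't a Num.int)
    (U : set 'rV[R]_((2 * F + 1) * (2 * n))) (U_nbhd : well_defined_nbhd M U)
    (w : 'rV[R]_((2 * F + 1) * (2 * n))) (Uw : U w) :
  exists r : R,
    [/\ h_1_dom M w r,
        h_1 M w r = 0,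
        forall t : R, h_1_dom M w t -> h_1 M w t = 0 -> t = r &
        forall i : 'I_(2 * F + 1),
          if f_1 w <= level i <= f_2 w then
            1 - proj_mu M w r - (level i)%:~R * proj_lambda M w r != 0 /\
            block (projM M w) i =
              (1 - proj_mu M w r - (level i)%:~R * proj_lambda M w r)^-1 *: block w i
          else block (projM M w) i = 0].
Proof.
have [_ UO Uuniq] := U_nbhd.
have [/block_neq0_of_sum_gt0[j0 j0M wj0] /block_neq0_of_sum_gt0[j1 Mj1 wj1]] :=
  UO _ Uw.
have [i0 wi0 f1E] := f_1_attained wj0.
have [i1 wi1 f2E] := f_2_attained wj1.
pose P := [pred i : 'I_(2 * F + 1) | f_1 w <= level i <= f_2 w].
pose m (i : 'I_(2 * F + 1)) : R := (level i)%:~R - M.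
pose a i := norm2 (block w i) ^+ 2.
have supp i : block w i != 0 -> P i by move=> wi; rewrite /= f_1_le ?f_2_ge.
have w0 i : ~~ P i -> block w i = 0.
  by move=> nPi; apply/eqP; apply: contraNT nPi => /supp.
have p0 : (f_1 w)%:~R - M < 0.
  by rewrite subr_lt0; apply: le_lt_trans j0M; rewrite ler_int f_1_le.
have q0 : 0 < (f_2 w)%:~R - M.
  by rewrite subr_gt0; apply: lt_le_trans Mj1 _; rewrite ler_int f_2_ge.
have mpq i : P i -> (f_1 w)%:~R - M <= m i <= (f_2 w)%:~R - M.
  by move=> /andP[? ?]; rewrite !lerD2r !ler_int; apply/andP.
have a0 i : 0 <= a i by apply: sqr_ge0.
have agt i : block w i != 0 -> 0 < a i.
  by move=> wi; rewrite lt0r a0 norm2_sqr_eq0 wi.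
have [r [rd hr runiq]] : exists r, [/\
    ((f_1 w)%:~R - M)^-1 < r < ((f_2 w)%:~R - M)^-1, h_1 M w r = 0 &
    forall t, ((f_1 w)%:~R - M)^-1 < t < ((f_2 w)%:~R - M)^-1 ->
      h_1 M w t = 0 -> t = r].
  apply: (@secular_root _ _ P m a _ _ i0 i1) => //; rewrite ?agt //.
  - exact: supp.
  - by rewrite /m f1E.
  - exact: supp.
  - by rewrite /m f2E.
have dgt i : P i -> 0 < 1 - m i * r.
  by move=> Pi; apply: secular_denom_gt0 p0 q0 (mpq i Pi) rd.
have s0 : 0 < proj_scale M w r.
  rewrite sqrtr_gt0 (bigD1 i0) /=; last exact: supp.
  apply: ltr_pwDl; first by rewrite divr_gt0 ?agt // exprn_gt0 // dgt // supp.
  by apply: sumr_ge0 => i _; rewrite divr_ge0 ?sqr_ge0.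
set s := proj_scale M w r in s0.
have denE i : 1 - proj_mu M w r - (level i)%:~R * proj_lambda M w r =
    s * (1 - m i * r).
  by rewrite /proj_mu /proj_lambda /m -/s; ring.
have uM := scaled_point_in_manifold s0 hr.
rewrite -/s in uM; set u := scale_blocks _ _ in uM.
have uE i : block u i = if P i then (s * (1 - m i * r))^-1 *: block w i else 0.
  by rewrite block_scale_blocks /=; case: ifP => _ //; rewrite scale0r.
have [z [zmin zuniq]] := Uuniq _ Uw.
have projE : projM M w = z by apply: xget_unique => // y /zuniq.
have affE i : s * (1 + M * r) + (- s * r) * (level i)%:~R = s * (1 - m i * r).
  by rewrite /m; ring.
have wE i :
    block w i = (s * (1 + M * r) + (- s * r) * (level i)%:~R) *: block u i.
  rewrite affE uE; case: ifPn => [Pi|/w0->]; last by rewrite scaler0.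
  by rewrite scalerA mulfV ?scale1r // mulf_neq0 ?gt_eqF ?dgt.
have zu0 i : ~~ P i -> block z i - block u i = 0.
  move=> nPi; rewrite uE (negbTE nPi) subr0.
  exact: minimizer_block_eq0 zmin zuniq (w0 i nPi).
have zE : z = u.
  pose D i := s * (1 - m i * r) * norm2 (block z i - block u i) ^+ 2.
  have D0 i : 0 <= D i.
    have [Pi|/zu0 zui] := boolP (P i).
      by rewrite mulr_ge0 ?sqr_ge0 // ltW // mulr_gt0 ?dgt.
    by rewrite /D zui (eqP (_ : norm2 0 ^+ 2 == 0)) ?mulr0 ?norm2_sqr_eq0.
  have sumD : \sum_i D i == 0.
    rewrite eq_le sumr_ge0 // andbT.
    have := zmin.2 _ uM; rewrite ler_pM2l ?invr_gt0 // -subr_le0.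
    by rewrite (dist_defect uM zmin.1 wE); under eq_bigr do rewrite affE.
  apply: block_inj => i; apply/eqP; rewrite -subr_eq0.
  have [Pi|/zu0->//] := boolP (P i).
  move: sumD; rewrite psumr_eq0 // => /allP/(_ i (mem_index_enum i)) /=.
  by rewrite mulf_eq0 norm2_sqr_eq0 mulf_eq0 !gt_eqF ?dgt.
exists r; split=> //.
move=> i; rewrite denE projE zE uE /=.
case: (boolP (P i)) => /= [Pi|/negbTE Pi]; rewrite !Pi //.
by split=> //; rewrite mulf_neq0 ?gt_eqF ?dgt.
Qed.
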